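(* Let $n\ge 2$ be an even integer, let $X_1,\ldots,X_n$ be independent random variables, each uniformly distributed on $(0,1)$, and let $f_n$ denote the probability density (the Irwin--Hall density) of $Y_n=\sum_{i=1}^n X_i$ on $[0,n]$. Then $$\int_0^{n/2} y f_n(y)\,\mathrm{d}y=\frac{n}{4}-\frac{n^{n+1}}{(n+1)!}\left(\frac12\right)^{n+1}\sum_{j=0}^{n/2}(-1)^j\binom{n}{j}\left(1-\frac{2j}{n}\right)^{n+1}.$$
   Context: The Irwin--Hall density on $[0,n]$ is given explicitly by $f_n(y)=\frac{1}{(n-1)!}\sum_{j=0}^{[y]}(-1)^j\binom{n}{j}(y-j)^{n-1}$, with cumulative distribution function $F_n(y)=\frac{1}{n!}\sum_{j=0}^{[y]}(-1)^j\binom{n}{j}(y-j)^{n}$, where $[y]$ is the largest integer not exceeding $y$. *)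

(* Defs.v *)
From HB Require Import structures.
From mathcomp Require Import all_boot all_order all_algebra.
From mathcomp Require Import all_classical all_reals all_analysis.

Set Implicit Arguments.
Unset Strict Implicit.
Unset Printing Implicit Defensive.

Import Order.TTheory GRing.Theory Num.Theory.
Import numFieldNormedType.Exports.

Local Open Scope classical_set_scope.
Local Open Scope ring_scope.

(* Mutual (not merely pairwise) independence: the product rule is required
   for every finite subfamily. *)
Definition independent_RVs (d : measure_display) (T : measurableType d)
    (R : realType) (P : probability T R) (I : finType)
    (X : I -> {RV P >-> R}) : Prop :=
  forall (J : {set I}) (A : I -> set R), (forall i, measurable (A i)) ->
    P (\bigcap_(i in [set` J]) (X i @^-1` A i)) =
    (\prod_(i in J) P (X i @^-1` A i))%E.

(* [uniform_prob] lives on the closed interval; this is the same law as the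
   uniform law on the open interval. *)
Definition uniform01 (d : measure_display) (T : measurableType d)
    (R : realType) (P : probability T R) (X : {RV P >-> R}) : Prop :=
  forall A : set R, measurable A ->
    distribution P X A = uniform_prob (@ltr01 R) A.

(* [f] is a density on [D] of the law of [Y]: the law is concentrated on [D]
   (take [A := ~` D]); values of [f] outside of [D] are irrelevant. *)
Definition density_on (d : measure_display) (T : measurableType d)
    (R : realType) (P : probability T R) (Y : T -> R)
    (D : set R) (f : R -> R) : Prop :=
  [/\ measurable_fun D f,
      (forall y, D y -> 0 <= f y) &
      forall A : set R, measurable A ->
        pushforward P Y A =
        (\int[@lebesgue_measure R]_(y in A `&` D) (f y)%:E)%E].

(* Main.v *)
(* Write [c = n / 2], [Y] for the sum and [F] for its distribution function.
   Integrating [c - y] against the density and exchanging the integrals gives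
     [\int_0^c y f(y) dy = c F(c) - \int_0^c F(c - u) du].
   Conditioning on one summand, [F_(m+1)(x) = \int_0^1 F_m(x - u) du], which
   by Pascal's rule yields the Irwin-Hall formula for [F] in terms of truncated
   powers and, by one more integration, the sum of [n+1]-st powers in the
   statement. The same recursion run with untruncated powers is constantly [1];
   pairing the terms [j] and [n - j] then shows [F(c) = 1 / 2] for even [n]. *)
Require Import Defs.
From HB Require Import structures.
From mathcomp Require Import all_boot all_order all_algebra.
From mathcomp Require Import all_classical all_reals all_analysis.
From mathcomp Require Import measurable_realfun ring lra.

Set Implicit Arguments.
Unset Strict Implicit.
Unset Printing Implicit Defensive.

Import Order.TTheory GRing.Theory Num.Theory.
Import numFieldNormedType.Exports.

Local Open Scope classical_set_scope.
Local Open Scope ring_scope.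

(** * Truncated powers and Irwin-Hall sums *)

Section IrwinHallFormula.
Context {R : realType}.
Local Notation mu := (@lebesgue_measure R).

Lemma integral_powB k (x b : R) : 0 <= b ->
  (\int[mu]_(u in `[0%R, b]) ((x - u) ^+ k)%:E =
   ((x ^+ k.+1 - (x - b) ^+ k.+1) / k.+1%:R)%:E)%E.
Proof.
rewrite le_eqVlt => /predU1P[<-|b0].
  by rewrite set_itv1 integral_set1 subr0 subrr mul0r.
pose F (u : R) : R := - k.+1%:R^-1 *: (x - u) ^+ k.+1.
have dF (u : R) : is_derive u 1 F ((x - u) ^+ k).
  have h : is_derive u 1 (- k.+1%:R^-1 \*: (cst x - id) ^+ k.+1) _ :=
    is_deriveZ _ (is_deriveX k.+1
      (is_deriveB (@is_derive_cst R R R x u 1) (@is_derive_id R R u 1))).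
  have -> : F = - k.+1%:R^-1 \*: (cst x - id) ^+ k.+1.
    by apply/funext => y; rewrite /F !fctE.
  apply: (is_derive_eq h).
  rewrite sub0r scalerN /GRing.scale/= mulr1 mulrNN mulrA mulVf ?mul1r//.
have cF u : {for u, continuous F}.
  by apply: differentiable_continuous; apply/derivable1_diffP; have [] := dF u.
rewrite (@continuous_FTC2 _ _ F)//=.
- by rewrite /F subr0 /GRing.scale/= !mulNr opprK -EFinD addrC -mulrBr mulrC.
- apply: continuous_subspaceT => u.
  apply: (@continuous_comp _ _ _ (fun u => x - u) (fun y : R => y ^+ k)).
    by apply: cvgB; [exact: cvg_cst|exact: cvg_id].
  exact: exprn_continuous.
- split.
  + by move=> u _; have [] := dF u.
  + exact/cvg_at_right_filter/cF.
  + exact/cvg_at_left_filter/cF.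
- by move=> u _; rewrite derive1E; exact: derive_val.
Qed.

Lemma integrable_powB k (x b : R) :
  mu.-integrable `[0, b] (fun u => ((x - u) ^+ k)%:E).
Proof.
apply: continuous_compact_integrable; first exact: segment_compact.
apply: continuous_subspaceT => u.
apply: (@continuous_comp _ _ _ (fun u => x - u) (fun y : R => y ^+ k)).
  by apply: cvgB; [exact: cvg_cst|exact: cvg_id].
exact: exprn_continuous.
Qed.

(** The value at 0 matters for [k = 0]: [trunc_pow 0] is the indicator of the closed half-line, the
    distribution function of the empty sum. *)
Definition trunc_pow k (x : R) : R := if 0 <= x then x ^+ k else 0.

Lemma measurable_trunc_pow k : measurable_fun setT (trunc_pow k).
Proof.
by apply: measurable_fun_ifT => //=; exact: measurable_fun_ler.
Qed.

(** For [0 <= x] the integrand vanishes past [u = x], so the integral is that of the plain power up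
    to [Num.min b x]. *)
Lemma integral_trunc_powB k (x b : R) : 0 <= b ->
  (\int[mu]_(u in `[0%R, b]) (trunc_pow k (x - u))%:E =
   ((trunc_pow k.+1 x - trunc_pow k.+1 (x - b)) / k.+1%:R)%:E)%E.
Proof.
move=> b0; have [x0|x0] := ltP x 0.
  rewrite /trunc_pow !ifF ?subr_gt0 ?subrr ?mul0r; [|lra..].
  rewrite integral0_eq// => u /=; rewrite in_itv/= => /andP[u0 _].
  by rewrite ifF//; lra.
rewrite (_ : trunc_pow _ x - _ = x ^+ k.+1 - (x - Num.min b x) ^+ k.+1); last first.
  rewrite /trunc_pow x0 subr_ge0; case: (leP b x) => bx //.
  by rewrite subrr expr0n.
rewrite -integral_powB ?le_min ?b0//.
rewrite integral_mkcond [RHS]integral_mkcond; apply: eq_integral => u _.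
rewrite !patchE !mem_setE !in_itv/= le_min /trunc_pow subr_ge0.
by case: (0 <= u) => //=; case: (u <= b) => //=; case: ifP.
Qed.

Lemma integrable_trunc_powB k (x b : R) : 0 <= b ->
  mu.-integrable `[0, b] (fun u => (trunc_pow k (x - u))%:E).
Proof.
move=> b0; apply/integrableP; split.
  apply/measurable_EFinP/measurable_funTS/measurableT_comp.
    exact: measurable_trunc_pow.
  exact: measurable_funB.
rewrite [ltLHS](_ : _ = \int[mu]_(u in `[0%R, b]) (trunc_pow k (x - u))%:E)%E.
  by rewrite integral_trunc_powB// ltry.
apply: eq_integral => u _; rewrite gee0_abs// lee_fin /trunc_pow.
by case: ifP => // ?; exact: exprn_ge0.
Qed.

(* Shared by truncated and plain powers, so that the convolution recursion
   below is proved once for both. *)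
Definition sliding_primitive (phi : nat -> R -> R) := forall k x b, 0 <= b ->
  mu.-integrable `[0, b] (fun u => (phi k (x - u))%:E) /\
  (\int[mu]_(u in `[0%R, b]) (phi k (x - u))%:E =
   ((phi k.+1 x - phi k.+1 (x - b)) / k.+1%:R)%:E)%E.

Lemma sliding_primitive_exp : sliding_primitive (fun k x => x ^+ k).
Proof. by move=> k x b b0; split; [exact: integrable_powB|exact: integral_powB]. Qed.

Lemma sliding_primitive_trunc_pow : sliding_primitive trunc_pow.
Proof.
by move=> k x b b0; split; [exact: integrable_trunc_powB|exact: integral_trunc_powB].
Qed.

(* With truncated powers this is the Irwin-Hall distribution function for
   [k = m], its density for [k = m - 1] and its primitive for [k = m + 1]. *)
Definition irwin_hall (phi : nat -> R -> R) m k x : R :=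
  k`!%:R^-1 * \sum_(0 <= j < m.+1) (-1) ^+ j * 'C(m, j)%:R * phi k (x - j%:R).

(** Pascal's rule: shifting the index in one of the two sums flips its sign and moves [x] to
    [x - 1]. *)
Lemma irwin_hallS phi m k x :
  irwin_hall phi m.+1 k x = irwin_hall phi m k x - irwin_hall phi m k (x - 1).
Proof.
rewrite /irwin_hall -mulrBr; congr (_ * _).
rewrite big_nat_recl//.
under eq_bigr do rewrite binS natrD mulrDr mulrDl.
rewrite big_split/= addrA; congr (_ + _).
  transitivity (\sum_(0 <= j < m.+2) (-1) ^+ j * 'C(m, j)%:R * phi k (x - j%:R)).
    by rewrite [RHS]big_nat_recl//= !bin0.
  by rewrite big_nat_recr//= bin_small// mulr0 mul0r addr0.
rewrite -sumrN; apply: eq_bigr => j _.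
rewrite exprS mulN1r !mulNr; congr (- (_ * phi _ _)).
by rewrite -natr1 opprD addrAC addrA.
Qed.

(** For [b = 1] the right-hand side is [irwin_hall phi m.+1 k.+1 x] by [irwin_hallS], which is the
    convolution recursion; [b = n / 2] serves for the last integration. *)
Lemma integral_irwin_hall phi m k x b : sliding_primitive phi -> 0 <= b ->
  (\int[mu]_(u in `[0%R, b]) (irwin_hall phi m k (x - u))%:E =
   (irwin_hall phi m k.+1 x - irwin_hall phi m k.+1 (x - b))%:E)%E.
Proof.
move=> phiP b0.
pose c j : R := k`!%:R^-1 * ((-1) ^+ j * 'C(m, j)%:R).
transitivity (\int[mu]_(u in `[0%R, b])
    \sum_(0 <= j < m.+1) ((c j)%:E * (phi k (x - j%:R - u))%:E))%E.
  apply: eq_integral => u _; rewrite /irwin_hall mulr_sumr -sumEFin; apply: eq_bigr => j _.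
  by rewrite -EFinM /c mulrA addrAC.
rewrite integral_sum//; last first.
  by move=> j; apply: integrableZl => //; have [] := phiP k (x - j%:R) b b0.
rewrite /irwin_hall -mulrBr -sumrB mulr_sumr -sumEFin; apply: eq_bigr => j _.
have [h1 h2] := phiP k (x - j%:R) b b0.
rewrite integralZl// h2 -EFinM /c (addrAC x (- b)); congr _%:E.
rewrite factS natrM invfM.
set a := k.+1%:R^-1; set a' := k`!%:R^-1; ring.
Qed.

(** The [m]-th backward difference of [x ^+ m] is [m!]; inductively, the constant 1 is integrated
    over an interval of length 1. *)
Lemma irwin_hall_exp m x : irwin_hall (fun k y => y ^+ k) m m x = 1.
Proof.
elim: m x => [|m IH] x.
  by rewrite /irwin_hall big_nat1 fact0 bin0 !expr0 invr1 !mulr1.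
apply: EFin_inj.
rewrite irwin_hallS -(integral_irwin_hall _ _ _ sliding_primitive_exp)//.
under eq_integral do rewrite IH.
by rewrite integral_cst//= lebesgue_measure_itv/= lte_fin ltr01 mul1e sube0.
Qed.

Lemma irwin_hall_trunc_pow0 x : irwin_hall trunc_pow 0 0 x = (0 <= x)%R%:R.
Proof.
rewrite /irwin_hall big_nat1 fact0 bin0 expr0 invr1 !mul1r subr0.
by rewrite /trunc_pow expr0; case: (0 <= x).
Qed.

Lemma irwin_hall_trunc_pow_half n k :
  irwin_hall trunc_pow n k (n%:R / 2) =
  k`!%:R^-1 * \sum_(0 <= j < (n %/ 2).+1)
     (-1) ^+ j * 'C(n, j)%:R * (n%:R / 2 - j%:R) ^+ k.
Proof.
rewrite /irwin_hall; congr (_ * _).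
(* Indices above [n %/ 2] give negative arguments, where truncated powers vanish. *)
rewrite (@big_cat_nat _ _ _ (n %/ 2).+1)//=; last by rewrite ltnS leq_div.
rewrite [X in _ + X]big_nat_cond [X in _ + X]big1 ?addr0; last first.
  move=> j; rewrite andbT => /andP[nj _].
  rewrite /trunc_pow ifF ?mulr0//; apply/negbTE; rewrite -ltNge subr_lt0.
  by rewrite ltr_pdivrMr// -natrM ltr_nat -ltn_divLR.
apply: eq_big_nat => j; rewrite ltnS => /andP[_ nj].
rewrite /trunc_pow ifT// subr_ge0 ler_pdivlMr// -natrM ler_nat.
by rewrite -leq_divRL.
Qed.

(** Only [j = 0] has a nonnegative argument, and the positive exponent makes that term zero. *)
Lemma irwin_hall_trunc_pow_at0 n k : irwin_hall trunc_pow n k.+1 0 = 0.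
Proof.
rewrite /irwin_hall big1 ?mulr0// => j _; rewrite /trunc_pow sub0r.
case: ifP => [|_]; last by rewrite mulr0.
by rewrite oppr_ge0 lern0 => /eqP ->; rewrite oppr0 expr0n mulr0.
Qed.

Lemma trunc_powDN n (y : R) : (0 < n)%N -> ~~ odd n ->
  trunc_pow n y + trunc_pow n (- y) = y ^+ n.
Proof.
move=> n0 /negbTE n_even; rewrite /trunc_pow oppr_ge0.
rewrite exprNn -signr_odd n_even mul1r.
by case: (ltgtP y 0) => [||->]; rewrite ?add0r ?addr0// expr0n gtn_eqF// addr0.
Qed.

(** Reversing the index negates [n / 2 - j] and, [n] being even, preserves sign and binomial; twice
    the truncated sum is thus the plain-power sum. *)
Lemma irwin_hall_trunc_pow_median n : (0 < n)%N -> ~~ odd n ->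
  irwin_hall trunc_pow n n (n%:R / 2) = 1 / 2.
Proof.
move=> n0 n_even.
suff : irwin_hall trunc_pow n n (n%:R / 2) + irwin_hall trunc_pow n n (n%:R / 2) =
    1 by lra.
rewrite -[RHS](irwin_hall_exp n (n%:R / 2)) /irwin_hall -mulrDr; congr (_ * _).
rewrite [X in _ + X]big_nat_rev/= -big_split/=; apply: eq_big_nat => j /andP[_ jn].
rewrite add0n subSS bin_sub// -(signr_odd _ (n - j)) oddB// (negbTE n_even)/= signr_odd.
rewrite -mulrDr -(trunc_powDN _ n0)//; congr (_ * (_ + trunc_pow n _)).
rewrite natrB//; lra.
Qed.

End IrwinHallFormula.

(** * Sums of independent variables, by conditioning on one summand *)

Section SumOfIndependent.
Local Open Scope ereal_scope.

(** Bundles an image measure as a finite measure, for use in product measures; the existential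
    exposes only its values. *)
Lemma pushforward_finite_measure d1 d2 (T1 : measurableType d1)
    (T2 : measurableType d2) (R : realType)
    (Q : {finite_measure set T1 -> \bar R}) (f : T1 -> T2) :
  measurable_fun setT f ->
  exists m : {finite_measure set T2 -> \bar R}, forall B, m B = Q (f @^-1` B).
Proof.
move=> mf.
have [m mE] : exists m : {measure set T2 -> \bar R}, forall B, m B = Q (f @^-1` B).
  by unshelve eexists (pushforward Q f).
have m_fin : fin_num_fun m.
  move=> B mB; rewrite mE; apply: (fin_num_measure Q).
  by rewrite -[X in measurable X]setTI; exact: mf.
have m_sigma : sigma_finite setT m.
  by apply: fin_num_fun_sigma_finite; rewrite ?measure0.
pose H1 := isFinite.Build _ _ _ m m_fin.
pose H2 := isSFinite.Build _ _ _ m (sfinite_measure_sigma_finite m_sigma).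
pose H3 := isSigmaFinite.Build _ _ _ m m_sigma.
by exists (HB.pack_for (FiniteMeasure.type T2 R) (Measure.sort m) H1 H2 H3).
Qed.

Lemma measurable_add_preimage (R : realType) (A : set R) : measurable A ->
  measurable [set z : R * measurableTypeR R | A (z.1 + z.2)%R].
Proof.
move=> mA; rewrite -[X in measurable X]setTI.
exact: (@measurable_funD _ (R * measurableTypeR R)%type R setT fst snd).
Qed.

Context d (T : measurableType d) (R : realType).

(** By uniqueness of product measures the joint law is a product. [Q] is a mere finite measure so
    that restrictions of [P] to an event are allowed. *)
Lemma independent_addE (Q : {finite_measure set T -> \bar R})
    (nu : {sigma_finite_measure set (measurableTypeR R) -> \bar R}) (Y Z : {mfun T >-> R}) :
  (forall A B, measurable A -> measurable B ->
    Q (Y @^-1` A `&` Z @^-1` B) = Q (Y @^-1` A) * nu B) ->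
  forall A, measurable A ->
    Q ((Y \+ Z)%R @^-1` A) = \int[nu]_u Q (Y @^-1` [set y | A (y + u)%R]).
Proof.
move=> YZ A mA.
have [m12 m12E] : exists m : {finite_measure set (R * measurableTypeR R)%type -> \bar R},
    forall B, m B = Q ((fun t => (Y t, Z t)) @^-1` B).
  apply: pushforward_finite_measure.
  apply: (@measurable_fun_pair _ _ _ T R (measurableTypeR R)).
    exact: measurable_funPT.
  exact: (measurable_funPT Z).
have [m1 m1E] : exists m : {finite_measure set R -> \bar R},
    forall B, m B = Q (Y @^-1` B).
  exact: pushforward_finite_measure.
pose C : set (R * measurableTypeR R) := [set z | A (z.1 + z.2)%R].
have mC : measurable C by exact: measurable_add_preimage.
transitivity (m12 C); first by rewrite m12E.
have E : forall X, measurable X -> (m1 \x nu) X = m12 X.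
  apply: product_measure_unique => B D mB mD.
  by rewrite /= m12E m1E -YZ.
(* The other product measure has the second coordinate as its outer variable, as the integral over
   [u] demands. *)
have E' : forall X, measurable X -> (m1 \x nu) X = (m1 \x^ nu) X.
  by apply: product_measure_unique => B D mB mD; exact: product_measure2E.
rewrite -E// E'//; apply: eq_integral => u _ /=.
rewrite m1E; congr (Q (_ @^-1` _)).
by apply/seteqP; split => y; rewrite /ysection/= inE.
Qed.

Lemma measurable_translated_preimage (Q : {finite_measure set T -> \bar R})
    (Y : {mfun T >-> R}) (A : set R) : measurable A ->
  measurable_fun setT (fun u : measurableTypeR R => Q (Y @^-1` [set y | A (y + u)%R])).
Proof.
move=> mA.
have [m1 m1E] : exists m : {finite_measure set R -> \bar R},
    forall B, m B = Q (Y @^-1` B).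
  exact: pushforward_finite_measure.
pose C : set (R * measurableTypeR R) := [set z | A (z.1 + z.2)%R].
have mC : measurable C by exact: measurable_add_preimage.
rewrite [X in measurable_fun _ X](_ : _ = m1 \o ysection C).
  exact: measurable_fun_ysection.
apply/funext => u /=; rewrite m1E; congr (Q (_ @^-1` _)).
by apply/seteqP; split => y; rewrite /ysection/= inE.
Qed.

Context (P : probability T R) (I : finType) (X : I -> {mfun T >-> R}).

Local Notation event K B := (\bigcap_(k in [set` K]) X k @^-1` B k).

Lemma measurable_event (K : {set I}) (B : I -> set R) :
  (forall k, measurable (B k)) -> measurable (event K B).
Proof.
move=> mB; apply: fin_bigcap_measurable; first exact: finite_finpred.
by move=> k _; exact: measurable_funPTI.
Qed.

Lemma event_setU1 (K : {set I}) (B : I -> set R) i D : i \notin K ->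
  event (i |: K)%SET [eta B with i |-> D] = X i @^-1` D `&` event K B.
Proof.
move=> iK; apply/seteqP; split => [t h|t [Dt h] k /=].
  split; first by have := h i; rewrite /= setU11 eqxx; exact.
  move=> k /= kK; have := h k; rewrite /= setU1r// => /(_ erefl).
  by case: eqP => // ki; rewrite -ki kK in iK.
rewrite in_setU1; case: eqP => [->//|_ /= kK]; exact: h.
Qed.

(* Keeping an event on the remaining variables makes the induction on [J] go
   through: a new summand is moved out of that event. *)
Definition indep_of_sum (J : {set I}) := forall (K : {set I}) (A : set R) B,
  {in J, forall j, j \notin K} -> measurable A -> (forall k, measurable (B k)) ->
  P ((\sum_(i in J) X i)%R @^-1` A `&` event K B) =
  P ((\sum_(i in J) X i)%R @^-1` A) * P (event K B).

(* Lebesgue-based measures live on [measurableTypeR R], whose structure is not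
   convertible to the canonical one of [R], hence [nu] instead of the law. *)
Variable nu : probability (measurableTypeR R) R.
Hypothesis X_law : forall i A, measurable A -> P (X i @^-1` A) = nu A.
Hypothesis X_indep : independent_RVs (X : I -> {RV P >-> R}).

Lemma P_event_setU1 (K : {set I}) (B : I -> set R) i D : i \notin K ->
  measurable D -> (forall k, measurable (B k)) ->
  P (X i @^-1` D `&` event K B) = P (X i @^-1` D) * P (event K B).
Proof.
move=> iK mD mB; rewrite -event_setU1// !X_indep//; last first.
  by move=> k /=; case: eqP.
rewrite big_setU1//= eqxx; congr (_ * _); apply: eq_bigr => k kK.
by case: eqP => // ki; rewrite -ki kK in iK.
Qed.

Lemma indep_of_sum_setU1_integral (J K : {set I}) i (A : set R) B :
  indep_of_sum J -> i \notin J -> {in (i |: J)%SET, forall j, j \notin K} ->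
  measurable A -> (forall k, measurable (B k)) ->
  P ((\sum_(j in (i |: J)%SET) X j)%R @^-1` A `&` event K B) =
  (\int[nu]_u
    P ((\sum_(j in J) X j)%R @^-1` [set y | A (y + u)%R])) * P (event K B).
Proof.
move=> IH iJ JK mA mB.
have iK : i \notin K by apply: JK; rewrite setU11.
have {}JK : {in J, forall j, j \notin K} by move=> j jJ; rewrite JK ?setU1r.
pose mE := measurable_event K mB.
have mAu u : measurable [set y | A (y + u)%R].
  by rewrite -[X in measurable X]setTI; apply: measurable_funD.
rewrite -ge0_integralZr//; last exact: measurable_translated_preimage.
under eq_integral do rewrite -IH//.
rewrite big_setU1//= addrC.
(* With [P] restricted to the event on [K], the product hypothesis follows by absorbing the
   condition on [X i] into that event and applying [IH] with [i] added to [K]. *)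
apply: (@independent_addE (mrestr P mE)) => // A' D mA' mD.
rewrite /= /mrestr -setIA -event_setU1// IH//; last 2 first.
- move=> j jJ; rewrite in_setU1 negb_or JK// andbT.
  by apply: contraNneq iJ => <-.
- by move=> k /=; case: eqP.
by rewrite event_setU1// P_event_setU1// IH// X_law// muleCA muleC.
Qed.

Lemma sum_setU1_integral (J : {set I}) i (A : set R) :
  indep_of_sum J -> i \notin J -> measurable A ->
  P ((\sum_(j in (i |: J)%SET) X j)%R @^-1` A) =
  \int[nu]_u
    P ((\sum_(j in J) X j)%R @^-1` [set y | A (y + u)%R]).
Proof.
move=> IH iJ mA.
have := @indep_of_sum_setU1_integral J finset.set0 i A (fun=> setT) IH iJ _ mA
  (fun=> measurableT).
rewrite (_ : event finset.set0 _ = setT); last first.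
  by apply/seteqP; split => // t _ k /=; rewrite inE.
by rewrite setIT probability_setT mule1; apply => j _; rewrite inE.
Qed.

(** Induction on the cardinality: conditioning on one summand expresses both sides through the same
    integral. *)
Lemma indep_of_sumP (J : {set I}) : indep_of_sum J.
Proof.
elim: {J}#|J| {-2}J (erefl #|J|) => [|m IH] J.
  move/eqP; rewrite finset.cards_eq0 => /eqP -> K A B _ mA mB.
  rewrite big_set0; have [A0|A0] := pselect (A 0%R).
    rewrite (_ : _ @^-1` A = setT) ?setTI ?probability_setT ?mul1e//.
    by apply/seteqP; split.
  rewrite (_ : _ @^-1` A = set0) ?set0I ?measure0 ?mul0e//.
  by apply/seteqP; split.
move=> Jm; have /card_gt0P[i iJ] : (0 < #|J|)%N by rewrite Jm.
rewrite -(finset.setD1K iJ) => K A B JK mA mB.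
have iJ' : i \notin (J :\ i)%SET by rewrite !inE eqxx.
have IHJ : indep_of_sum (J :\ i)%SET.
  by apply: IH; move: Jm; rewrite (finset.cardsD1 i) iJ => -[].
by rewrite indep_of_sum_setU1_integral// sum_setU1_integral.
Qed.

End SumOfIndependent.

(** * Distribution function of a sum of uniform variables *)

Section SumOfUniform.
Local Open Scope ereal_scope.
Context d (T : measurableType d) (R : realType) (P : probability T R).
Context (I : finType) (X : I -> {mfun T >-> R}).
Hypothesis X_indep : independent_RVs (X : I -> {RV P >-> R}).
Hypothesis X_unif : forall i, uniform01 (X i : {RV P >-> R}).

Lemma sum_uniform_cdf (J : {set I}) x :
  P ((\sum_(i in J) X i)%R @^-1` `]-oo, x]) =
  (irwin_hall trunc_pow #|J| #|J| x)%:E.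
Proof.
have [m Jm] : exists m, #|J| = m by exists #|J|.
rewrite Jm; elim: m J Jm x => [|m IH] J.
  move/eqP; rewrite finset.cards_eq0 => /eqP -> x.
  rewrite big_set0 irwin_hall_trunc_pow0; case: (boolP (0 <= x)%R) => x0.
    rewrite (_ : _ @^-1` _ = setT) ?probability_setT//.
    by apply/seteqP; split => // t _ /=; rewrite in_itv.
  rewrite (_ : _ @^-1` _ = set0) ?measure0//.
  by apply/seteqP; split => // t /=; rewrite in_itv/= (negbTE x0).
move=> Jm x; have /card_gt0P[i iJ] : (0 < #|J|)%N by rewrite Jm.
have iJ' : i \notin (J :\ i)%SET by rewrite !inE eqxx.
have J'm : #|(J :\ i)%SET| = m by move: Jm; rewrite (finset.cardsD1 i) iJ => -[].
pose nu : probability (measurableTypeR R) R := uniform_prob (@ltr01 R).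
have X_law j A : measurable A -> P (X j @^-1` A) = nu A by exact: X_unif.
rewrite -(finset.setD1K iJ) (sum_setU1_integral X_law X_indep _ iJ')//; last first.
  exact: (indep_of_sumP X_law X_indep).
have IH' := IH _ J'm.
(* Nonnegativity, hidden in the alternating sum, is read off the probabilities; it is a side
   condition of [integral_uniform]. *)
have F0 (y : R) : (0 <= irwin_hall trunc_pow m m y)%R by rewrite -lee_fin -IH'.
transitivity (\int[uniform_prob (@ltr01 R)]_u (irwin_hall trunc_pow m m (x - u))%:E).
  apply: eq_integral => u _; rewrite -IH'; congr (P (_ @^-1` _)).
  by apply/seteqP; split => y /=; rewrite !in_itv/= lerBrDr.
rewrite integral_uniform; last 2 first.
- apply/measurable_EFinP/measurable_funM => //; apply: measurable_sum => j.
  apply: measurable_funM => //; apply: measurableT_comp.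
    exact: measurable_trunc_pow.
  by do 2 apply: measurable_funB => //.
- by move=> u; rewrite lee_fin.
rewrite irwin_hallS subr0 invr1 mul1e integral_irwin_hall//.
exact: sliding_primitive_trunc_pow.
Qed.

End SumOfUniform.

(** * Partial first moment of a density *)

Section Density.
Context d (T : measurableType d) (R : realType) (P : probability T R).
Variables (Y : T -> R) (b : R) (f : R -> R).
Hypothesis f_density : density_on P Y `[0, b] f.
Local Notation mu := (@lebesgue_measure R).
Local Open Scope ereal_scope.

Lemma integral_density_itv c : (c <= b)%R ->
  \int[mu]_(y in `[0%R, c]) (f y)%:E = P (Y @^-1` `]-oo, c]).
Proof.
move=> cb; have [_ _ fP] := f_density.
have := fP `]-oo, c]%classic (measurable_itv _); rewrite /pushforward => ->.
congr (integral _ _ _); apply/seteqP; split => y /=; rewrite !in_itv/=.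
  by move=> /andP[y0 yc]; rewrite yc y0/= (le_trans yc).
by move=> [yc /andP[-> _]].
Qed.

(** Write [c - y] as the length of the segment of [u] with [0 <= u <= c - y], and apply Tonelli. *)
Lemma integral_density_layer c : (0 <= c <= b)%R ->
  \int[mu]_(y in `[0%R, c]) ((c - y) * f y)%:E =
  \int[mu]_(u in `[0%R, c]) P (Y @^-1` `]-oo, (c - u)%R]).
Proof.
move=> /andP[c0 cb]; have [mf f0 _] := f_density.
(* Extension by zero makes the density measurable and nonnegative on the whole line. *)
pose g := f \_ `[0%R, b].
have mg : measurable_fun setT g by apply/(measurable_restrictT _ _).1.
have g0 y : (0 <= g y)%R.
  by rewrite /g patchE; case: ifPn => // /set_mem; exact: f0.
(* The density, as a function of the first coordinate, cut off to the triangle under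
   [z.1 + z.2 = c]. *)
pose h (z : R * R) : R :=
  if [&& 0 <= z.1, 0 <= z.2 & z.1 + z.2 <= c]%R then g z.1 else 0%R.
have h0 z : 0 <= (h z)%:E by rewrite lee_fin /h; case: ifP.
have mh : measurable_fun setT (EFin \o h).
  apply/measurable_EFinP/measurable_fun_ifT => //=; last exact: measurableT_comp.
  apply: measurable_and; first exact: measurable_fun_ler.
  apply: measurable_and; first exact: measurable_fun_ler.
  by apply: measurable_fun_ler => //; exact: measurable_funD.
have := @fubini_tonelli _ _ _ _ _ mu mu (EFin \o h) mh h0.
rewrite [LHS](_ : _ = \int[mu]_(y in `[0%R, c]) ((c - y) * f y)%:E); last first.
  rewrite [RHS]integral_mkcond; apply: eq_integral => y _ /=.
  rewrite patchE mem_setE in_itv/=; case: ifPn => yc.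
    transitivity (\int[mu]_(u in `[0%R, (c - y)%R]) (f y)%:E).
      rewrite [RHS]integral_mkcond; apply: eq_integral => u _.
      rewrite patchE mem_setE in_itv/= /h/=; move/andP: yc => [y0 yc].
      rewrite y0/= lerBrDl; case: ifP => // _.
      by rewrite /g patchE mem_setE in_itv/= y0 (le_trans yc).
    rewrite integral_cst//= lebesgue_measure_itv/= lte_fin subr_gt0.
    move/andP: yc => [y0]; rewrite le_eqVlt => /predU1P[->|->].
      by rewrite ltxx mule0 subrr mul0r.
    by rewrite oppr0 adde0 -EFinM mulrC.
  apply: integral0_eq => u _; rewrite /h/=; case: ifP => // /and3P[y0 u0 yuc].
  by rewrite y0/= in yc; exfalso; move: yc; rewrite -ltNge; lra.
move=> ->; rewrite [RHS]integral_mkcond; apply: eq_integral => u _ /=.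
rewrite patchE mem_setE in_itv/=; case: ifPn => uc.
  move/andP: uc => [u0 uc].
  rewrite -integral_density_itv; last by lra.
  rewrite [RHS]integral_mkcond; apply: eq_integral => y _.
  rewrite patchE mem_setE in_itv/= /h/= u0/= lerBrDr; case: ifP => // /andP[y0 yuc].
  by rewrite /g patchE mem_setE in_itv/= ifT// y0/=; lra.
apply: integral0_eq => y _; rewrite /h/=; case: ifP => // /and3P[y0 u0 yuc].
by rewrite u0/= in uc; exfalso; move: uc; rewrite -ltNge; lra.
Qed.

(** Integrates [y + (c - y) = c] against the density; the additive form avoids subtracting extended
    reals. *)
Lemma integral_density_first_moment c : (0 <= c <= b)%R ->
  \int[mu]_(y in `[0%R, c]) (y * f y)%:E +
  \int[mu]_(u in `[0%R, c]) P (Y @^-1` `]-oo, (c - u)%R]) =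
  c%:E * P (Y @^-1` `]-oo, c]).
Proof.
move=> /[dup] c0b /andP[c0 cb]; have [mf f0 _] := f_density.
have c_sub : `[0%R, c] `<=` `[0%R, b].
  by move=> y /=; rewrite !in_itv/= => /andP[-> /le_trans->].
have mfc : measurable_fun `[0%R, c] f by exact: measurable_funS mf.
rewrite -integral_density_layer// -integral_density_itv//.
rewrite -ge0_integralD//; last 4 first.
- move=> y /[dup] /c_sub /f0 fy /=; rewrite in_itv/= => /andP[y0 _].
  by rewrite lee_fin mulr_ge0.
- by apply/measurable_EFinP/measurable_funM.
- move=> y /[dup] /c_sub /f0 fy /=; rewrite in_itv/= => /andP[_ yc].
  by rewrite lee_fin mulr_ge0// subr_ge0.
- by apply/measurable_EFinP/measurable_funM => //; exact: measurable_funB.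
rewrite -ge0_integralZl//; last 2 first.
- exact/measurable_EFinP.
- by move=> y /c_sub /f0; rewrite lee_fin.
by apply: eq_integral => y _; rewrite -EFinD -EFinM -mulrDl addrC subrK.
Qed.

End Density.

Theorem lemma1 (d : measure_display) (T : measurableType d) (R : realType)
    (P : probability T R) (n : nat) (n_ge2 : (2 <= n)%N) (n_even : ~~ odd n)
    (X : 'I_n -> {RV P >-> R})
    (X_indep : independent_RVs X)
    (X_unif : forall i : 'I_n, uniform01 (X i))
    (f : R -> R)
    (f_density : density_on P (fun t => \sum_(i < n) X i t) `[0, n%:R] f) :
  (\int[@lebesgue_measure R]_(y in `[0%R, (n%:R / 2)%R]) (y * f y)%:E)%E =
  (n%:R / 4 -
   n%:R ^+ n.+1 / (n.+1)`!%:R * (1 / 2) ^+ n.+1 *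
   \sum_(0 <= j < (n %/ 2).+1)
      (-1) ^+ j * 'C(n, j)%:R * (1 - (2 * j%:R) / n%:R) ^+ n.+1)%:E.
Proof.
have n0 : (0 < n)%N by exact: leq_trans n_ge2.
have nR : n%:R != 0 :> R by rewrite pnatr_eq0 -lt0n.
have c0 : 0 <= n%:R / 2 :> R by rewrite divr_ge0.
have sumE : (fun t => \sum_(i < n) X i t) =
    (\sum_(i in [set: 'I_n]%SET) (X i : {mfun T >-> R}) : {mfun T >-> R}).
  apply/funext => t; rewrite mfun_sum.
  by apply: eq_bigl => i; rewrite finset.in_setT.
have cdfE x : P ((fun t => \sum_(i < n) X i t) @^-1` `]-oo, x]) =
    (irwin_hall trunc_pow n n x)%:E.
  by rewrite sumE sum_uniform_cdf// finset.cardsT card_ord.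
pose c : R := n%:R / 2.
have c0n : 0 <= c <= n%:R.
  by rewrite c0 ler_piMr// invf_le1// ler1n.
have := integral_density_first_moment f_density c0n.
under [X in (_ + X)%E]eq_integral do rewrite cdfE.
rewrite integral_irwin_hall//; last exact: sliding_primitive_trunc_pow.
(* The product on the right becomes [n / 2 * (1 / 2)], the source of [n / 4]; the primitive vanishes
   at [c - c = 0]. *)
rewrite cdfE /c irwin_hall_trunc_pow_median// subrr irwin_hall_trunc_pow_at0 subr0.
rewrite irwin_hall_trunc_pow_half; set A := (X in (_ + X%:E)%E).
move/(congr1 (fun z => z - A%:E)%E); rewrite addeK// => ->.
rewrite -EFinM -EFinB; congr (_ - _)%:E; first by lra.
rewrite /A !mulr_sumr; apply: eq_bigr => j _.
(* Factoring [n / 2] out of each base yields the powers of [n] and of [1 / 2] in front of the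
   sum. *)
have -> : n%:R / 2 - j%:R = n%:R * (1 / 2) * (1 - 2 * j%:R / n%:R) :> R by field.
by rewrite !exprMn; ring.
Qed.
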